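(* Let $(a,b)\in\mathfrak{R}$. Then the sets $\mathcal{A}_1$ and $\mathcal{A}_2$ are $L_{a,b}$-invariant and $L_{a,b}^{-1}$-invariant, i.e. $L_{a,b}(\mathcal{A}_i)\subseteq\mathcal{A}_i$ and $L_{a,b}^{-1}(\mathcal{A}_i)\subseteq\mathcal{A}_i$ for $i=1,2$.
   Context: For real $a,b$ with $0<b<1$ and $a+b>1$, the Lozi map is the homeomorphism $L_{a,b}:\mathbb{R}^2\to\mathbb{R}^2$, $L_{a,b}(x,y)=(1+y-a|x|,\,bx)$. For $A\in\mathbb{R}^2$ and $k\in\mathbb{Z}$ put $A^k=L_{a,b}^k(A)$. $L_{a,b}$ has two fixed points, both hyperbolic saddles: $X=\left(\frac{1}{1+a-b},\frac{b}{1+a-b}\right)$ and $Y=\left(\frac{1}{1-a-b},\frac{b}{1-a-b}\right)$. It has a period-two orbit $\{P,P'\}$ with $P=\left(\frac{1+a-b}{a^2+(1-b)^2},\frac{b(1-a-b)}{a^2+(1-b)^2}\right)$, $P'=\left(\frac{1-a-b}{a^2+(1-b)^2},\frac{b(1+a-b)}{a^2+(1-b)^2}\right)$. For $Q\in\{X,Y\}$ let $W_Q^s=\{A\in\mathbb{R}^2: A^n\to Q \text{ as } n\to\infty\}$ and $W_Q^u=\{A\in\mathbb{R}^2: A^{-n}\to Q\text{ as }n\to\infty\}$. $\mathfrak{R}$ denotes the set of pairs $(a,b)$ with $0<b<1$, $a+b>1$, $W_X^u\cap W_X^s=\{X\}$, and such that the period-two orbit $\{P,P'\}$ is attracting (all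 points of some neighborhood of $\{P,P'\}$ have forward orbits converging to $\{P,P'\}$). For $(a,b)\in\mathfrak{R}$ the complement $\mathbb{R}^2\setminus W_Y^s$ has exactly two connected components; $\mathcal{A}_1$ denotes the one containing $X$, and $\mathcal{A}_2$ the other one. *)

(* Defs.v *)
From mathcomp Require Import all_boot all_order all_algebra.
From mathcomp Require Import all_classical all_reals all_analysis.
From mathcomp Require Import ring.
Set Implicit Arguments.
Unset Strict Implicit.
Unset Printing Implicit Defensive.
Import Order.TTheory GRing.Theory Num.Theory.
Import numFieldNormedType.Exports.
Local Open Scope classical_set_scope.
Local Open Scope ring_scope.

(* The plane is [R * R] with its product topology, [R] being any model of the
   real numbers. *)

Definition lozi (R : realType) (a b : R) (A : R * R) : R * R :=
  (1 + A.2 - a * `|A.1|, b * A.1).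

(* Solving [lozi a b (x', y') = (x, y)] gives x' = y / b and
   y' = x - 1 + a |y / b|; see [loziK] and [lozi_invK]. *)
Definition lozi_inv (R : realType) (a b : R) (A : R * R) : R * R :=
  (A.2 / b, A.1 - 1 + a * `|A.2 / b|).

Lemma loziK (R : realType) (a b : R) (hb : b != 0) :
  cancel (lozi a b) (lozi_inv a b).
Proof.
case=> x y; rewrite /lozi_inv /lozi /= [b * x]mulrC mulfK//.
by congr (_, _); ring.
Qed.

Lemma lozi_invK (R : realType) (a b : R) (hb : b != 0) :
  cancel (lozi_inv a b) (lozi a b).
Proof.
case=> x y; rewrite /lozi_inv /lozi /= [b * _]mulrC divfK//.
by congr (_, _); ring.
Qed.

Definition fixX (R : realType) (a b : R) : R * R :=
  ((1 + a - b)^-1, b / (1 + a - b)).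

Definition fixY (R : realType) (a b : R) : R * R :=
  ((1 - a - b)^-1, b / (1 - a - b)).

Definition perP (R : realType) (a b : R) : R * R :=
  ((1 + a - b) / (a ^+ 2 + (1 - b) ^+ 2),
   b * (1 - a - b) / (a ^+ 2 + (1 - b) ^+ 2)).

Definition perP' (R : realType) (a b : R) : R * R :=
  ((1 - a - b) / (a ^+ 2 + (1 - b) ^+ 2),
   b * (1 + a - b) / (a ^+ 2 + (1 - b) ^+ 2)).

Definition Wstable (R : realType) (a b : R) (Q : R * R) : set (R * R) :=
  [set A | (fun n : nat => iter n (lozi a b) A) @ \oo --> Q].

Definition Wunstable (R : realType) (a b : R) (Q : R * R) : set (R * R) :=
  [set A | (fun n : nat => iter n (lozi_inv a b) A) @ \oo --> Q].

(* Convergence to the set [S] means: eventually inside every neighborhood of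
   [S]. *)
Definition attracting (R : realType) (a b : R) (S : set (R * R)) : Prop :=
  exists2 N : set (R * R), set_nbhs S N &
    forall A, N A ->
      (fun n : nat => iter n (lozi a b) A) @ \oo `=>` set_nbhs S.

Definition frakR (R : realType) : set (R * R) :=
  [set p | [/\ 0 < p.2 < 1, 1 < p.1 + p.2,
     Wunstable p.1 p.2 (fixX p.1 p.2) `&` Wstable p.1 p.2 (fixX p.1 p.2)
       = [set fixX p.1 p.2] &
     attracting p.1 p.2 [set perP p.1 p.2; perP' p.1 p.2]]].

Definition components (T : topologicalType) (U : set T) : set (set T) :=
  connected_component U @` U.

Definition calA1 (R : realType) (a b : R) : set (R * R) :=
  connected_component (~` Wstable a b (fixY a b)) (fixX a b).

(* For parameters in [frakR] the complement of the stable set of [fixY] has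
   exactly two components.  So as not to have to assume this, "the other
   component" is written as the union of all components different from
   [calA1]; [calA2_unique] shows that it is the second component as soon as
   there are exactly two. *)
Definition calA2 (R : realType) (a b : R) : set (R * R) :=
  \bigcup_(C in components (~` Wstable a b (fixY a b)) `\ calA1 a b) C.

Lemma calA2_unique (R : realType) (a b : R) (C : set (R * R)) :
  components (~` Wstable a b (fixY a b)) = [set calA1 a b; C] ->
  C <> calA1 a b -> calA2 a b = C.
Proof.
rewrite /calA2 => -> CA; have -> : [set calA1 a b; C] `\ calA1 a b = [set C].
  by apply/seteqP; split=> D /=; [move=> [[->|->] //] | move=> ->; split; [right|]].
exact: bigcup_set1.
Qed.

(* Main.v *)
Require Import Defs.
From mathcomp Require Import all_boot all_order all_algebra.
From mathcomp Require Import all_classical all_reals all_analysis.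
From mathcomp Require Import lra.
Import Order.TTheory GRing.Theory Num.Theory.
Import numFieldNormedType.Exports.
Local Open Scope classical_set_scope.
Local Open Scope ring_scope.

(** The stable set of [Y] is invariant under the homeomorphism [L] in both
    directions, so [L] and its inverse map connected subsets of its complement
    to connected subsets of its complement. Those through [X] stay through [X]
    because [X] is fixed; and a homeomorphism that preserves both the complement
    and the component of [X] preserves the rest of the complement. *)

Lemma image_connected_component_fixed (T : topologicalType) (f : T -> T)
    (U : set T) (x : T) : continuous f -> f x = x -> f @` U `<=` U ->
  f @` connected_component U x `<=` connected_component U x.
Proof.
move=> fc fx fU _ [y [C [Cx CU Cc] Cy] <-]; exists (f @` C); last by exists y.
split; first by exists x.
- by apply: subset_trans fU; exact: image_subset.
- by apply: connected_continuous_connected => //; exact: continuous_subspaceT.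
Qed.

(** Components that share a point coincide. This turns [calA2] into a set difference, where points
    can be tracked without naming their components. *)
Lemma bigcup_components_setD1 (T : topologicalType) (U : set T) (x : T) :
  \bigcup_(C in components U `\ connected_component U x) C
  = U `\` connected_component U x.
Proof.
apply/seteqP; split=> [z [_ [[y Uy <-]] ne yz]|z [Uz xz]].
  split; first exact: connected_component_sub yz.
  move=> xz; apply: ne.
  by rewrite (same_connected_component xz) (same_connected_component yz).
have zz : connected_component U z z by exact: connected_component_refl.
exists (connected_component U z) => //; split; first by exists z.
by move=> e; apply: xz; rewrite -e.
Qed.

Lemma lozi_continuous (R : realType) (a b : R) : continuous (lozi a b).
Proof.
move=> A.
have cvg1 : 1 + B.2 - a * `|B.1| @[B --> A] --> 1 + A.2 - a * `|A.1|.
  apply: cvgB; first by apply: cvgD; [exact: cvg_cst | exact: cvg_snd].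
  by apply: cvgM; [exact: cvg_cst | apply: cvg_norm; exact: cvg_fst].
have cvg2 : b * B.1 @[B --> A] --> b * A.1.
  by apply: cvgM; [exact: cvg_cst | exact: cvg_fst].
exact: cvg_pair cvg1 cvg2.
Qed.

Lemma lozi_inv_continuous (R : realType) (a b : R) : continuous (lozi_inv a b).
Proof.
move=> A.
have cvg1 : B.2 / b @[B --> A] --> A.2 / b.
  by apply: cvgM; [exact: cvg_snd | exact: cvg_cst].
have cvg2 : B.1 - 1 + a * `|B.2 / b| @[B --> A] --> A.1 - 1 + a * `|A.2 / b|.
  apply: cvgD; first by apply: cvgB; [exact: cvg_fst | exact: cvg_cst].
  by apply: cvgM; [exact: cvg_cst | exact: cvg_norm].
exact: cvg_pair cvg1 cvg2.
Qed.

Lemma lozi_fixX (R : realType) (a b : R) : 0 < 1 + a - b ->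
  lozi a b (fixX a b) = fixX a b.
Proof.
move=> d0; rewrite /lozi /fixX /= gtr0_norm ?invr_gt0//; congr (_, _).
apply: (mulIf (lt0r_neq0 d0)).
by rewrite mulrBl mulrDl mul1r !divfK ?mulVf ?gt_eqF//; lra.
Qed.

(** The two orbits differ by a shift of one. As an equality it rewrites both ways, which serves
    [lozi] and [lozi_inv] alike. *)
Lemma Wstable_lozi (R : realType) (a b : R) (Q A : R * R) :
  Wstable a b Q (lozi a b A) = Wstable a b Q A.
Proof.
rewrite propeqE /Wstable /=; under eq_fun do rewrite -iterSr.
split=> cvgA; last exact: cvg_comp _ _ (@cvg_addnl 1%N) cvgA.
(* Truncated subtraction gives [0 - 1 = 0], so reindexing by [n - 1] recovers the orbit of [A] only
   from [n = 1] on. *)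
have := cvg_comp _ _ (@cvg_subnr 1%N) cvgA; apply: cvg_trans.
by apply: near_eq_cvg; exists 1%N => // -[//|n] _ /=; rewrite subn1.
Qed.

Theorem lemma3p16 (R : realType) (a b : R) (hab : frakR (a, b)) :
  [/\ lozi a b @` calA1 a b `<=` calA1 a b,
      lozi_inv a b @` calA1 a b `<=` calA1 a b,
      lozi a b @` calA2 a b `<=` calA2 a b &
      lozi_inv a b @` calA2 a b `<=` calA2 a b].
Proof.
case: hab => /= /andP[b0 b1] ab1 _ _.
have bn0 : b != 0 by rewrite gt_eqF.
(* Here [1 + a - b > 2 (1 - b) > 0]. *)
have LX : lozi a b (fixX a b) = fixX a b by apply: lozi_fixX; lra.
have MX : lozi_inv a b (fixX a b) = fixX a b by rewrite -{1}LX loziK.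
set U := ~` Wstable a b (fixY a b).
have LU : lozi a b @` U `<=` U.
  by move=> _ [A UA <-]; rewrite /U /setC /= Wstable_lozi.
have MU : lozi_inv a b @` U `<=` U.
  by move=> _ [A UA <-]; rewrite /U /setC /= -Wstable_lozi lozi_invK.
have L1 : lozi a b @` calA1 a b `<=` calA1 a b.
  exact: image_connected_component_fixed (@lozi_continuous R a b) LX LU.
have M1 : lozi_inv a b @` calA1 a b `<=` calA1 a b.
  exact: image_connected_component_fixed (@lozi_inv_continuous R a b) MX MU.
rewrite /calA2 bigcup_components_setD1 -/U -/(calA1 a b).
split=> // _ [A [UA nA] <-]; split.
- by apply: LU; exists A.
(* Were the image in [calA1], the inverse map would bring [A] back into [calA1]. *)
- by move=> A1; apply: nA; rewrite -(loziK a bn0 A); apply: M1; exists (lozi a b A).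
- by apply: MU; exists A.
- by move=> A1; apply: nA; rewrite -(lozi_invK a bn0 A); apply: L1; exists (lozi_inv a b A).
Qed.
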